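(* Let $H:\mathbb R_+\to(0,1)$ be continuous and satisfy: (H1) there are constants $0<h_1<h_2<1$ with $h_1\le H_t\le h_2$ for all $t\ge0$; (H2) there are constants $D>0$, $\kappa\in(0,1]$ with $|H_t-H_s|\le D|t-s|^\kappa$ for all $t\ge s>0$. Let $Y$ be the multifractional Brownian motion with Hurst function $H$. Then for any $\delta>0$ there exists a nonnegative random variable $\xi=\xi(\delta)$ such that almost surely, for all $t>0$, \[ |Y(t)|\le (t^{h_2+\delta}\vee1)\,\xi, \] and there exist positive constants $C_1=C_1(\delta)$, $C_2=C_2(\delta)$ such that $\mathbb P(\xi>u)\le C_1e^{-C_2u^2}$ for all $u>0$.
   Context: The (harmonizable) multifractional Brownian motion with continuous functional parameter $H$ is $Y(t)=\int_{\mathbb R}\frac{e^{itu}-1}{|u|^{H_t+1/2}}\widetilde W(du)$, $t\ge0$, where $\widetilde W$ is the Fourier transform of real Gaussian white noise $W$, i.e. the unique complex-valued random measure with $\int_{\mathbb R}f(u)W(du)=\int_{\mathbb R}\widehat f(u)\widetilde W(du)$ a.s. for all $f\in L^2(\mathbb R)$. *)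

(* Defs.v *)
From HB Require Import structures.
From mathcomp Require Import all_boot all_order all_algebra.
From mathcomp Require Import all_classical all_reals all_analysis.
Set Implicit Arguments. Unset Strict Implicit. Unset Printing Implicit Defensive.
Import Order.TTheory GRing.Theory Num.Theory.
Import numFieldNormedType.Exports.
Local Open Scope classical_set_scope.
Local Open Scope ring_scope.

(* Covariance kernel of the harmonizable multifractional Brownian motion:
   K(t,s) = int_R (e^{itu}-1) conj(e^{isu}-1) / |u|^{H_t+H_s+1} du
          = int_R (1 - cos(tu) - cos(su) + cos((t-s)u)) / |u|^{H_t+H_s+1} du
   (the imaginary part is odd in u and integrates to 0). *)
Definition mbm_cov {R : realType} (H : R -> R) (t s : R) : R :=
  Rintegral lebesgue_measure setT
    (fun u : R => (1 - cos (t * u) - cos (s * u) + cos ((t - s) * u))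
                  / (`|u| `^ (H t + H s + 1))).

Definition centered_gaussian {d} {T : measurableType d} {R : realType}
  (P : probability T R) (X : T -> R) (v : R) : Prop :=
  measurable_fun setT X /\
  (if 0 < v then
     forall A : set R, measurable A ->
       P (X @^-1` A) = normal_prob 0 (Num.sqrt v) A
   else {ae P, forall w, X w = 0}).

Definition is_mbm {d} {T : measurableType d} {R : realType}
  (P : probability T R) (H : R -> R) (c : R) (Y : R -> T -> R) : Prop :=
  forall (n : nat) (ts : 'I_n -> R) (a : 'I_n -> R),
    (forall i, 0 <= ts i) ->
    centered_gaussian P (fun w => \sum_(i < n) a i * Y (ts i) w)
      (\sum_(i < n) \sum_(j < n) a i * a j * (c * mbm_cov H (ts i) (ts j))).

(* Main.v *)
Require Import Defs.
From HB Require Import structures.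
From mathcomp Require Import all_boot all_order all_algebra.
From mathcomp Require Import all_classical all_reals all_analysis.
From mathcomp Require Import measurable_realfun zify ring lra.
Import Order.TTheory GRing.Theory Num.Theory.
Import numFieldNormedType.Exports.
Local Open Scope classical_set_scope.
Local Open Scope ring_scope.

(** Let th > 0 be a small exponent and let w_th be the weight
    |u|^(th-1) / (1 + |u|^th)^2, which is integrable on the line. The spectral
    density of Y(t) - Y(s) is dominated by C |t-s|^th N^(2 h2 + 3 th) w_th on
    [0, N], because |e^(ixu) - 1|^2 can be traded against any power of |xu| with
    exponent in [0, 2], and the change of the Hurst exponent costs one logarithm,
    absorbed by |u|^(+-th). Hence Var(Y(t) - Y(s)) <= C |t-s|^th N^(2 h2 + 3 th).
    On each [n, n+1] the path is controlled by chaining dyadic increments. The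
    variable xi is, up to a constant, the supremum of |Y(n)| / (n+1)^(h2+delta)
    and of all dyadic increments of level k in [n, n+1] divided by
    (n+1)^(h2+delta) rho^k; the gap between 2 delta and 3 th makes the union bound
    over (n, k) summable with a Gaussian tail. *)

(** * The spectral weight *)

(** For [0 < u] the weight is the derivative of [- th^-1 / (1 + u^th)]. Up to constants it is
    [|u|^(th-1)] near 0 and [|u|^(-th-1)] at infinity. *)
Definition spectral_weight {R : realType} (th u : R) : R :=
  `|u| `^ (th - 1) / (1 + `|u| `^ th) ^+ 2.

Lemma powR_continuous_at {R : realType} (p x : R) :
  0 < x -> {for x, continuous (@powR R ^~ p)}.
Proof.
move=> x0; apply: differentiable_continuous; apply/derivable1_diffP.
by apply: derivable_powR; rewrite in_itv/= x0.
Qed.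

Lemma spectral_weight_ge0 {R : realType} (th u : R) : 0 <= spectral_weight th u.
Proof. by rewrite divr_ge0 ?powR_ge0// sqr_ge0. Qed.

Lemma spectral_weightN {R : realType} (th u : R) :
  spectral_weight th (- u) = spectral_weight th u.
Proof. by rewrite /spectral_weight normrN. Qed.

Lemma measurable_spectral_weight {R : realType} (th : R) :
  measurable_fun [set: R] (spectral_weight th).
Proof.
rewrite /spectral_weight.
under eq_fun => u.
  rewrite -powR_invn ?addr_ge0 ?powR_ge0//.
  over.
apply: measurable_funM.
  exact: (measurableT_comp (measurable_powR _)).
apply: (measurableT_comp (measurable_powR _)).
apply: measurable_funD => //.
exact: (measurableT_comp (measurable_powR _)).
Qed.

Lemma spectral_weight_continuous_at {R : realType} (th x : R) :
  x != 0 -> {for x, continuous (spectral_weight th)}.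
Proof.
move=> x0; have nx0 : 0 < `|x| by rewrite normr_gt0.
have cn p : {for x, continuous (fun u : R => `|u| `^ p)}.
  apply: (@continuous_comp _ _ _ (fun u : R => `|u|) (@powR R ^~ p)).
    exact: norm_continuous.
  exact: powR_continuous_at.
apply: cvgM; first exact: cn.
apply: cvgV; first by rewrite expf_neq0// gt_eqF// ltr_pwDl// powR_ge0.
apply: (@continuous_comp _ _ _ (fun u : R => 1 + `|u| `^ th) (fun y : R => y ^+ 2)).
  by apply: cvgD; [exact: cvg_cst|exact: cn].
exact: exprn_continuous.
Qed.

Lemma is_derive_spectral_weight_primitive {R : realType} (th x : R) :
  0 < th -> 0 < x ->
  is_derive x 1 (fun u : R => - th^-1 * (1 + u `^ th)^-1) (spectral_weight th x).
Proof.
move=> th0 x0.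
have d0 : is_derive x 1 (fun u : R => 1 + u `^ th) (th * x `^ (th - 1)).
  have := is_deriveD (is_derive_cst (1 : R) x 1) (is_derive1_powR th x0).
  by rewrite add0r.
have n0 : 1 + x `^ th != 0 by rewrite gt_eqF// ltr_pwDl// powR_ge0.
have dZ := is_deriveZ (- th^-1) (@is_deriveV R (fun u : R => 1 + u `^ th) x _ 1 n0 d0).
apply: (is_derive_eq dZ).
rewrite /spectral_weight gtr0_norm//.
rewrite /GRing.scale/=.
by field; rewrite n0 gt_eqF.
Qed.

(** The primitive tends to 0 at infinity, so the integral is [th^-1 / (1 + a^th)]. The bound is
    uniform in [a], which lets [a] tend to 0. *)
Lemma integral_spectral_weight_ge {R : realType} (th a : R) :
  0 < th -> 0 < a ->
  (\int[lebesgue_measure]_(u in `[a, +oo[) (spectral_weight th u)%:E <= th^-1%:E)%E.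
Proof.
move=> th0 a0.
pose F (u : R) : R := - th^-1 * (1 + u `^ th)^-1.
have dF (x : R) : 0 < x -> is_derive x 1 F (spectral_weight th x).
  exact: is_derive_spectral_weight_primitive.
rewrite (@ge0_continuous_FTC2y _ (spectral_weight th) F a 0).
- rewrite -EFinB lee_fin sub0r /F mulNr opprK.
  rewrite ler_piMr// ?invr_ge0 ?(ltW th0)// invf_le1 ?lerDl ?powR_ge0//.
  by rewrite ltr_pwDl// powR_ge0.
- by move=> x _; exact: spectral_weight_ge0.
- apply: continuous_in_subspaceT => x; rewrite inE/= in_itv/= andbT => ax.
  by apply: spectral_weight_continuous_at; rewrite gt_eqF// (lt_le_trans a0).
- rewrite -(mulr0 (- th^-1)); apply: cvgMl_tmp.
  apply/(gtr0_cvgV0 (f := fun u : R => 1 + u `^ th)).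
    by near=> x; rewrite ltr_pwDl// powR_ge0.
  apply/cvgryPge => M; near=> x.
  (* [M] may be negative, while real powers are monotone only on nonnegative bases; hence the
     maximum with 0. *)
  have Mx : (Num.max M 0) `^ th^-1 <= x by near: x; exact: nbhs_pinfty_ge.
  apply: (@le_trans _ _ (x `^ th)); last by rewrite lerDr.
  have M1 : 0 <= Num.max M 0 by rewrite le_max lexx orbT.
  apply: (@le_trans _ _ (Num.max M 0)); first by rewrite le_max lexx.
  rewrite -[leLHS]powRr1// -(mulVf (lt0r_neq0 th0)) powRrM.
  by rewrite ge0_ler_powR// ?nnegrE ?(le_trans _ Mx) ?powR_ge0 ?(ltW th0).
- by move=> x ax; have [] := dF x (lt_trans a0 ax).
- apply: cvg_at_right_filter.
  apply: differentiable_continuous; apply/derivable1_diffP.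
  by have [] := dF a a0.
- move=> x; rewrite in_itv/= andbT => ax.
  by rewrite derive1E; have [_ ->] := dF x (lt_trans a0 ax).
Unshelve. all: by end_near. Qed.

(** The sets [F n] increase to the complement of 0, which has full measure. Reflection exchanges the
    two half-lines of [F n], each contributes at most [th^-1], and monotone convergence
    concludes. *)
Lemma integrable_spectral_weight {R : realType} (th : R) : 0 < th ->
  lebesgue_measure.-integrable [set: R] (EFin \o spectral_weight th).
Proof.
move=> th0.
have mG : measurable_fun [set: R] (EFin \o spectral_weight th).
  by apply/measurable_EFinP; exact: measurable_spectral_weight.
have G0 (u : R) : (0 <= (spectral_weight th u)%:E)%E.
  by rewrite lee_fin spectral_weight_ge0.
pose a n : R := n.+1%:R^-1.
have a0 n : 0 < a n by rewrite invr_gt0.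
pose F n : set R := `]-oo, - a n] `|` `[a n, +oo[.
have mF n : measurable (F n) by apply: measurableU.
have FU : \bigcup_n F n = [set~ (0 : R)].
  apply/seteqP; split => u /=.
    move=> [n _ [|]]; rewrite /= in_itv/= ?andbT => un u0.
      by move: un; rewrite u0 oppr_ge0 leNgt a0.
    by move: un; rewrite u0 leNgt a0.
  move=> /eqP u0.
  have [n nu] : exists n, a n < `|u|.
    have u1 : 0 < `|u| by rewrite normr_gt0.
    have [n _ /(_ n (leqnn n))] := near_infty_natSinv_lt (PosNum u1).
    by exists n.
  exists n => //; rewrite /F /= !in_itv/= andbT.
  have [u1|u1] := leP 0 u; first by right; rewrite -(ger0_norm u1) ltW.
  by left; rewrite lerNr -(ltr0_norm u1) ltW.
have Fle n : (\int[lebesgue_measure]_(u in F n) (spectral_weight th u)%:E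
    <= (2 * th^-1)%:E)%E.
  rewrite /F ge0_integral_setU//=.
  - rewrite ge0_integration_by_substitutionNy.
    + rewrite (_ : (2 * th^-1) = th^-1 + th^-1); last by rewrite mulr_natl.
      rewrite EFinD leeD//; last exact: integral_spectral_weight_ge.
      under eq_integral do rewrite /= spectral_weightN.
      exact: integral_spectral_weight_ge.
    + apply: continuous_in_subspaceT => x; rewrite inE/= in_itv/= => ax.
      by apply: spectral_weight_continuous_at; rewrite lt_eqF// (le_lt_trans ax)// oppr_lt0.
    + by move=> x _; exact: spectral_weight_ge0.
  - exact: measurable_funTS.
  - apply/disj_setPS => u [/=]; rewrite !in_itv/= andbT => h1 h2.
    by have := a0 n; lra.
apply/integrableP; split => //.
under eq_integral do rewrite /= ger0_norm ?spectral_weight_ge0//.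
have nd : nondecreasing_seq F.
  apply/nondecreasing_seqP => n; apply/subsetPset => u [|]/=; rewrite !in_itv/= ?andbT => h.
    left; rewrite /= in_itv/= (le_trans h)// lerN2 lef_pV2 ?posrE//.
    by rewrite ler_nat.
  right; rewrite /= in_itv/= andbT (le_trans _ h)// lef_pV2 ?posrE//.
  by rewrite ler_nat.
have cv : (\int[lebesgue_measure]_(u in F n) (spectral_weight th u)%:E @[n --> \oo] -->
    \int[lebesgue_measure]_(u in \bigcup_n F n) (spectral_weight th u)%:E)%E.
  apply: ge0_nondecreasing_set_cvg_integral => //.
  by move=> n; exact: measurable_funTS.
have -> : (\int[lebesgue_measure]_u (spectral_weight th u)%:E =
    \int[lebesgue_measure]_(u in \bigcup_n F n) (spectral_weight th u)%:E)%E.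
  rewrite FU -[X in integral _ X _](setvU [set (0:R)]).
  rewrite ge0_integral_setU//=.
  - by rewrite integral_set1 adde0.
  - exact: measurableC.
  - by rewrite setvU.
  - by apply/disj_setPS => u [].
apply: (@le_lt_trans _ _ (2 * th^-1)%:E%E); last by rewrite ltry.
rewrite -(cvg_lim _ cv)//; apply: lime_le; first exact: cvgP cv.
by apply: nearW => n; exact: Fle.
Qed.

(** * Pointwise bounds on the spectral density *)

(** Once the larger exponential [e^x] is factored out, this is [1 + (y - x) <= e^(y - x)]. It serves
    to compare two powers of [|u|], written as exponentials of multiples of [log |u|]. *)
Lemma ler_norm_expRB {R : realType} (x y : R) :
  `|expR x - expR y| <= `|x - y| * expR (Num.max x y).
Proof.
wlog yx : x y / y <= x.
  move=> h; have /orP[/h//|/h {}h] := le_total y x.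
  by rewrite distrC (distrC x) maxC.
rewrite (max_idPl yx) !ger0_norm ?subr_ge0 ?ler_expR//.
have := expR_ge1Dx (y - x); have := expR_gt0 x; rewrite expRB => x0 h.
by move: h; rewrite ler_pdivlMr//; lra.
Qed.

(** With [x = log |u|], this absorbs a logarithm into [|u|^th] or [|u|^-th]. *)
Lemma ler_norm_expR {R : realType} (th x : R) :
  0 < th -> `|x| <= th^-1 * expR (th * `|x|).
Proof.
move=> th0; rewrite ler_pdivlMl//; have := expR_ge1Dx (th * `|x|); lra.
Qed.

Lemma ler_norm_sin {R : realType} (x : R) : `|sin x| <= `|x|.
Proof.
wlog x0 : x / 0 <= x.
  move=> h; have [/h//|x0] := leP 0 x.
  by have := h (- x); rewrite sinN !normrN; apply; lra.
have [->|xn0] := eqVneq x 0; first by rewrite sin0.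
have xp : 0 < x by rewrite lt_def xn0.
have [z _] : exists2 z, z \in `]0, x[ & sin x - sin 0 = cos z * (x - 0).
  apply: (@MVT R sin cos 0 x) => //.
  by apply: continuous_subspaceT => z; exact: continuous_sin.
rewrite sin0 !subr0 => ->; rewrite normrM ler_piMl//.
exact: cos_max.
Qed.

Lemma cos_sub_sqr {R : realType} (x : R) : 2 - 2 * cos x <= x ^+ 2.
Proof.
have -> : cos x = cos ((x / 2) *+ 2) by rewrite -mulr_natr mulfVK.
rewrite cos_mulr2n cos2sin2.
have : sin (x / 2) ^+ 2 <= (x / 2) ^+ 2.
  by rewrite -real_normK ?num_real// -[leRHS]real_normK ?num_real// lerXn2r ?nnegrE// ler_norm_sin.
by rewrite exprMn; lra.
Qed.

(** The left-hand side is [|e^(ix) - 1|^2]. The bound 4 suffices for [1 <= |x|], and the bound [x^2]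
    suffices below, where lowering the exponent increases the power. *)
Lemma cos_sub_powR {R : realType} (x p : R) :
  0 <= p <= 2 -> 2 - 2 * cos x <= 4 * `|x| `^ p.
Proof.
move=> /andP[p0 p2]; have [x1|x1] := leP 1 `|x|.
  have := cos_geN1 x; have := ler_powR x1 p0; rewrite powRr0; lra.
have [->|x0] := eqVneq x 0; first by rewrite cos0 mulr1 subrr mulr_ge0// powR_ge0.
apply: (le_trans (cos_sub_sqr x)).
have x01 : 0 < `|x| <= 1 by rewrite normr_gt0 x0 ltW.
have := ger_powR x01 p2.
rewrite powR_mulrn// real_normK ?num_real//; have := powR_ge0 `|x| p; lra.
Qed.

Lemma powR_expR {R : realType} (x p : R) : expR x `^ p = expR (p * x).
Proof. by rewrite mulrC expRM. Qed.

(** Here [x] stands for [log |u|]. With [z = e^(th x)] the weight is [e^(-x) z / (1 + z)^2], and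
    [z / (1 + z)^2] is at least a quarter of [min(z, 1/z)]. Pointwise bounds by the weight thus
    reduce to linear inequalities between exponents. *)
Lemma spectral_weight_ge {R : realType} (th x : R) : 0 < th ->
  expR (- x - th * `|x|) <= 4 * spectral_weight th (expR x).
Proof.
move=> th0; rewrite /spectral_weight (gtr0_norm (expR_gt0 x)) !powR_expR.
set z := expR (th * x).
have z0 : 0 < z by exact: expR_gt0.
have -> : expR ((th - 1) * x) = expR (- x) * z.
  by rewrite -expRD; congr expR; ring.
rewrite expRD mulrA ler_pdivlMr ?exprn_gt0 ?addr_gt0//.
rewrite (mulrCA 4) -mulrA ler_pM2l ?expR_gt0//.
have [x0|x0] := leP 0 x.
  have z1 : 1 <= z by rewrite -[X in X <= _]expR0 ler_expR mulr_ge0// ltW.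
  have : 0 <= (z - 1) * z by rewrite mulr_ge0 ?subr_ge0// ltW.
  by rewrite (ger0_norm x0) expRN -/z ler_pdivrMl//; nra.
have z1 : z <= 1 by rewrite -[leRHS]expR0 ler_expR nmulr_lle0// ltW.
have : 0 <= (1 - z) * z by rewrite mulr_ge0 ?subr_ge0// ltW.
by rewrite (ltr0_norm x0) mulrN opprK -/z; nra.
Qed.

Lemma expR_le_spectral_weight {R : realType} (th x e : R) : 0 < th ->
  e <= - x - th * `|x| -> expR e <= 4 * spectral_weight th (expR x).
Proof.
by move=> th0 h; apply: le_trans (spectral_weight_ge th x th0); rewrite ler_expR.
Qed.

(** For [|u| <= 1] the cosine is bounded with exponent [2 h2 + 3 th], which produces the power of
    [N]; for [|u| > 1] the bound 4 suffices because [th <= p]. *)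
Lemma cos_kernel_le {R : realType} (th h1 h2 N t u p : R) :
  0 < th -> 3 * th <= 2 * h1 -> 2 * h2 + 3 * th <= 2 ->
  0 <= t -> t <= N -> 1 <= N -> 2 * h1 <= p -> p <= 2 * h2 ->
  (2 - 2 * cos (t * u)) / `|u| `^ (p + 1) <=
  16 * N `^ (2 * h2 + 3 * th) * spectral_weight th u.
Proof.
move=> th0 hth1 hth2 t0 tN N1 p1 p2.
have Np : 1 <= N `^ (2 * h2 + 3 * th).
  by rewrite -[leLHS](powRr0 N) ler_powR//; lra.
have [->|u0] := eqVneq u 0.
  by rewrite mulr0 cos0 mulr1 subrr mul0r mulr_ge0 ?mulr_ge0 ?spectral_weight_ge0 ?(le_trans _ Np).
have [x xu] : exists x, expR x = `|u| by apply: expR_total; rewrite normr_gt0.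
have -> : spectral_weight th u = spectral_weight th (expR x).
  by rewrite xu /spectral_weight normr_id.
rewrite -powRN -xu powR_expR.
have [x0|x0] := leP x 0.
  have hp : 0 <= 2 * h2 + 3 * th <= 2 by apply/andP; split; lra.
  apply: (@le_trans _ _ (4 * (N `^ (2 * h2 + 3 * th) * expR ((2 * h2 + 3 * th) * x)) *
      expR (- (p + 1) * x))).
    rewrite ler_wpM2r ?expR_ge0//; apply: (le_trans (cos_sub_powR _ _ hp)).
    rewrite ler_wpM2l// normrM -xu (ger0_norm t0) powRM ?expR_ge0// powR_expR.
    rewrite ler_wpM2r ?expR_ge0// ge0_ler_powR// ?nnegrE//; lra.
  have qx : (2 * h2 + 3 * th) * x + - (p + 1) * x <= - x - th * `|x|.
    rewrite ler0_norm// -subr_ge0.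
    have -> : - x - th * - x - ((2 * h2 + 3 * th) * x + - (p + 1) * x) =
      (2 * h2 - p + 2 * th) * - x by ring.
    by rewrite mulr_ge0 ?oppr_ge0//; lra.
  have := expR_le_spectral_weight _ _ _ th0 qx; rewrite expRD.
  set A := expR _; set B := expR _; set G := spectral_weight _ _; set M := N `^ _.
  move=> AB; have : M * (A * B) <= M * (4 * G) by rewrite ler_wpM2l// (le_trans _ Np).
  lra.
have qx : - (p + 1) * x <= - x - th * `|x|.
  rewrite gtr0_norm// -subr_ge0.
  have -> : - x - th * x - - (p + 1) * x = (p - th) * x by ring.
  by rewrite mulr_ge0 ?(ltW x0)//; lra.
have := expR_le_spectral_weight _ _ _ th0 qx.
have c4 : 2 - 2 * cos (t * u) <= 4 by have := cos_geN1 (t * u); lra.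
have := expR_ge0 (- (p + 1) * x); have := spectral_weight_ge0 th (expR x).
set A := expR (- (p + 1) * x); set G := spectral_weight _ _; set M := N `^ _ in Np *.
move=> G0 A0 AG.
apply: (@le_trans _ _ (4 * A)); first by rewrite ler_wpM2r.
apply: (@le_trans _ _ (16 * 1 * G)); first by lra.
by rewrite ler_wpM2r// ler_wpM2l.
Qed.

(** Since [r <= 1], any exponent [q >= th] in [cos_sub_powR] yields the factor [r^th]. The choice
    [q = 2] gives integrability near 0, and [q = th] at infinity. *)
Lemma cos_increment_kernel_le {R : realType} (th h1 h2 r u p : R) :
  0 < th -> 3 * th <= 2 * h1 -> 2 * h2 + 3 * th <= 2 ->
  0 < r -> r <= 1 -> 2 * h1 <= p -> p <= 2 * h2 ->
  (2 - 2 * cos (r * u)) / `|u| `^ (p + 1) <= 16 * r `^ th * spectral_weight th u.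
Proof.
move=> th0 hth1 hth2 r0 r1 p1 p2.
have [->|u0] := eqVneq u 0.
  by rewrite mulr0 cos0 mulr1 subrr mul0r mulr_ge0 ?mulr_ge0 ?spectral_weight_ge0 ?powR_ge0.
have [x xu] : exists x, expR x = `|u| by apply: expR_total; rewrite normr_gt0.
have -> : spectral_weight th u = spectral_weight th (expR x).
  by rewrite xu /spectral_weight normr_id.
rewrite -powRN -xu powR_expR.
suff [q [hq qth qx]] : exists q, [/\ 0 <= q <= 2, th <= q &
    q * x + - (p + 1) * x <= - x - th * `|x|].
  apply: (@le_trans _ _ (4 * (r `^ th * expR (q * x)) * expR (- (p + 1) * x))).
    rewrite ler_wpM2r ?expR_ge0//; apply: (le_trans (cos_sub_powR _ _ hq)).
    rewrite ler_wpM2l// normrM -xu (gtr0_norm r0) powRM ?expR_ge0 ?(ltW r0)// powR_expR.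
    by rewrite ler_wpM2r ?expR_ge0// ger_powR// r0 r1.
  have := expR_le_spectral_weight _ _ _ th0 qx.
  rewrite expRD.
  set A := expR _; set B := expR _; set G := spectral_weight _ _; set M := r `^ _.
  move=> AB; have : M * (A * B) <= M * (4 * G) by rewrite ler_wpM2l// powR_ge0.
  lra.
have [x0|x0] := leP x 0.
  exists 2; split; [by rewrite lexx ler0n|lra|].
  rewrite ler0_norm// -subr_ge0.
  have -> : - x - th * - x - (2 * x + - (p + 1) * x) = (2 - p - th) * - x by ring.
  by rewrite mulr_ge0 ?oppr_ge0//; lra.
exists th; split => //; first by apply/andP; split; lra.
rewrite gtr0_norm// -subr_ge0.
have -> : - x - th * x - (th * x + - (p + 1) * x) = (p - 2 * th) * x by ring.
by rewrite mulr_ge0 ?(ltW x0)//; lra.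
Qed.

(** The squared logarithm costs [e^(2 th |x|)] and the comparison with the weight another
    [e^(th |x|)]. These three [th] are paid by the exponent [2 h2 + 3 th] of the cosine for
    [|u| <= 1], and by [3 th <= 2 h1] for [|u| > 1]. *)
Lemma hurst_increment_kernel_le {R : realType} (th h1 h2 N s u a b : R) :
  0 < th -> 3 * th <= 2 * h1 -> 2 * h2 + 3 * th <= 2 ->
  0 <= s -> s <= N -> 1 <= N -> h1 <= a <= h2 -> h1 <= b <= h2 -> u != 0 ->
  (`|u| `^ (- (a + 2^-1)) - `|u| `^ (- (b + 2^-1))) ^+ 2 * (2 - 2 * cos (s * u)) <=
  16 * (th^-1 * (a - b)) ^+ 2 * N `^ (2 * h2 + 3 * th) * spectral_weight th u.
Proof.
move=> th0 hth1 hth2 s0 sN N1 /andP[a1 a2] /andP[b1 b2] u0.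
have Np : 1 <= N `^ (2 * h2 + 3 * th).
  by rewrite -[leLHS](powRr0 N) ler_powR//; lra.
have [x xu] : exists x, expR x = `|u| by apply: expR_total; rewrite normr_gt0.
have -> : spectral_weight th u = spectral_weight th (expR x).
  by rewrite xu /spectral_weight normr_id.
rewrite -xu !powR_expR.
set m := Num.max (- (a + 2^-1) * x) (- (b + 2^-1) * x).
have dAB : (expR (- (a + 2^-1) * x) - expR (- (b + 2^-1) * x)) ^+ 2 <=
    (th^-1 * (a - b)) ^+ 2 * expR (2 * th * `|x| + 2 * m).
  have -> : 2 * th * `|x| + 2 * m = 2%:R * (th * `|x| + m) by ring.
  rewrite expRM_natl -exprMn -[leLHS]real_normK ?num_real//.
  rewrite -[leRHS]real_normK ?num_real// lerXn2r ?nnegrE//.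
  apply: (le_trans (ler_norm_expRB _ _)); rewrite -/m expRD.
  rewrite !normrM !(gtr0_norm (expR_gt0 _)) mulrA ler_wpM2r ?expR_ge0//.
  have -> : - (a + 2^-1) * x - - (b + 2^-1) * x = (b - a) * x by ring.
  rewrite normrM distrC (gtr0_norm (_ : 0 < th^-1)) ?invr_gt0//.
  rewrite -mulrA [leRHS]mulrCA ler_wpM2l//.
  exact: ler_norm_expR.
set W := N `^ _ in Np *.
(* [q] is the logarithm of the power of [|u|] spent on the cosine: [(2 h2 + 3 th) x] for [x <= 0],
   and 0 for [x > 0], where the bound 4 is enough. *)
suff [q [cq qx]] : exists q, 2 - 2 * cos (s * u) <= 4 * W * expR q /\
    2 * th * `|x| + 2 * m + q <= - x - th * `|x|.
  have c0 : 0 <= 2 - 2 * cos (s * u) by have := cos_le1 (s * u); lra.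
  apply: (le_trans (ler_pM (sqr_ge0 _) c0 dAB cq)).
  have := expR_le_spectral_weight _ _ _ th0 qx; rewrite expRD.
  set A := expR _; set B := expR _; set G := spectral_weight _ _.
  set C := _ ^+ 2 => AB.
  have : C * W * (A * B) <= C * W * (4 * G).
    by rewrite ler_wpM2l// mulr_ge0 ?sqr_ge0// (le_trans _ Np).
  lra.
have [x0|x0] := leP x 0.
  exists ((2 * h2 + 3 * th) * x); split.
    have hp : 0 <= 2 * h2 + 3 * th <= 2 by apply/andP; split; lra.
    apply: (le_trans (cos_sub_powR _ _ hp)).
    rewrite -mulrA ler_wpM2l// normrM -xu (ger0_norm s0) powRM ?expR_ge0// powR_expR.
    rewrite ler_wpM2r ?expR_ge0// ge0_ler_powR// ?nnegrE//; lra.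
  have mle : m <= - (h2 + 2^-1) * x by rewrite ge_max; apply/andP; split; nra.
  by rewrite ler0_norm//; nra.
exists 0; split.
  rewrite expR0 mulr1; have := cos_geN1 (s * u); lra.
have mle : m <= - (h1 + 2^-1) * x by rewrite ge_max; apply/andP; split; nra.
by rewrite gtr0_norm//; nra.
Qed.

Definition mbm_kernel {R : realType} (H : R -> R) (t s u : R) : R :=
  (1 - cos (t * u) - cos (s * u) + cos ((t - s) * u)) /
  (`|u| `^ (H t + H s + 1)).

Lemma mbm_covC {R : realType} (H : R -> R) (t s : R) : mbm_cov H t s = mbm_cov H s t.
Proof.
rewrite /mbm_cov; apply: eq_Rintegral => u _.
rewrite -(opprB s t) mulNr cosN (addrC (H t)); congr (_ / _); ring.
Qed.

Lemma mbm_kernel_diag {R : realType} (H : R -> R) (t u : R) :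
  mbm_kernel H t t u = (2 - 2 * cos (t * u)) / `|u| `^ (2 * H t + 1).
Proof.
rewrite /mbm_kernel subrr mul0r cos0; congr (_ / _ `^ _); ring.
Qed.

Lemma measurable_mbm_kernel {R : realType} (H : R -> R) (t s : R) :
  measurable_fun setT (mbm_kernel H t s).
Proof.
have mcos (a : R) : measurable_fun setT (fun u : R => cos (a * u)).
  apply: (measurableT_comp (f := @cos R)); last exact: mulrl_measurable.
  apply: continuous_measurable_fun; exact: continuous_cos.
rewrite /mbm_kernel; under eq_fun do rewrite -powRN.
apply: measurable_funM.
  apply: measurable_funD; last exact: mcos.
  apply: measurable_funB; last exact: mcos.
  by apply: measurable_funB; last exact: mcos.
exact: (measurableT_comp (measurable_powR _)).
Qed.

(** With [z = e^(ix) - 1] and [w = e^(iy) - 1], the left-hand side is the modulus of the real part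
    of [z] times the conjugate of [w]. The two signs follow from [|z + w|^2 >= 0] and
    [|z - w|^2 >= 0]. *)
Lemma cos_cross_norm_le {R : realType} (x y : R) :
  `|1 - cos x - cos y + cos (x - y)| <= (2 - 2 * cos x + (2 - 2 * cos y)) / 2.
Proof.
have ex := cos2Dsin2 x; have ey := cos2Dsin2 y.
rewrite cosB ler_norml; apply/andP; split.
  have := sqr_ge0 (1 - cos x + (1 - cos y)); have := sqr_ge0 (sin x + sin y).
  by move=> *; nra.
have := sqr_ge0 (cos x - cos y); have := sqr_ge0 (sin x - sin y).
by move=> *; nra.
Qed.

Lemma mbm_kernel_norm_le {R : realType} (H : R -> R) (th h1 h2 N t s u : R) :
  0 < th -> 3 * th <= 2 * h1 -> 2 * h2 + 3 * th <= 2 ->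
  0 <= t -> t <= N -> 0 <= s -> s <= N -> 1 <= N ->
  h1 <= H t <= h2 -> h1 <= H s <= h2 ->
  `|mbm_kernel H t s u| <= 16 * N `^ (2 * h2 + 3 * th) * spectral_weight th u.
Proof.
move=> th0 hth1 hth2 t0 tN s0 sN N1 /andP[ht1 ht2] /andP[hs1 hs2].
rewrite /mbm_kernel mulrBl normrM.
have p0 := powR_ge0 `|u| (H t + H s + 1).
rewrite (ger0_norm (_ : 0 <= _^-1)) ?invr_ge0//.
apply: (@le_trans _ _ ((2 - 2 * cos (t * u) + (2 - 2 * cos (s * u))) / 2 /
    `|u| `^ (H t + H s + 1))).
  by rewrite ler_wpM2r ?invr_ge0// cos_cross_norm_le.
(* The exponent [p] of [cos_kernel_le] is free in [[2 h1, 2 h2]], so both cosines can share the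
   mixed exponent [H t + H s]. *)
have hp1 : 2 * h1 <= H t + H s by lra.
have hp2 : H t + H s <= 2 * h2 by lra.
have := @cos_kernel_le R th h1 h2 N t u _ th0 hth1 hth2 t0 tN N1 hp1 hp2.
have := @cos_kernel_le R th h1 h2 N s u _ th0 hth1 hth2 s0 sN N1 hp1 hp2.
lra.
Qed.

Lemma integrable_mbm_kernel {R : realType} (H : R -> R) (th h1 h2 t s : R) :
  0 < th -> 3 * th <= 2 * h1 -> 2 * h2 + 3 * th <= 2 ->
  0 <= t -> 0 <= s -> h1 <= H t <= h2 -> h1 <= H s <= h2 ->
  lebesgue_measure.-integrable [set: R] (EFin \o mbm_kernel H t s).
Proof.
move=> th0 hth1 hth2 t0 s0 ht hs.
pose N := 1 + t + s; pose M := 16 * N `^ (2 * h2 + 3 * th).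
have M0 : 0 <= M by rewrite mulr_ge0// powR_ge0.
apply: (@le_integrable _ _ R lebesgue_measure _ measurableT _ (fun u : R => M%:E * (spectral_weight th u)%:E)%E) => //.
- by apply/measurable_EFinP; exact: measurable_mbm_kernel.
- move=> u _ /=; rewrite lee_fin (ger0_norm (mulr_ge0 M0 (spectral_weight_ge0 _ _))).
  by apply: (@mbm_kernel_norm_le R H th h1 h2 N) => //; rewrite /N; lra.
- by apply: integrableZl => //; exact: integrable_spectral_weight.
Qed.

(* With [A = |u|^-(H t + 1/2)] and [B = |u|^-(H s + 1/2)], the left-hand side is
   [|A (e^(itu) - 1) - B (e^(isu) - 1)|^2] and [A (e^(itu) - 1) - B (e^(isu) - 1)
   = A (e^(itu) - e^(isu)) + (A - B) (e^(isu) - 1)]. *)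
Lemma mbm_kernel_increment_split {R : realType} (H : R -> R) (t s u : R) :
  u != 0 ->
  mbm_kernel H t t u - 2 * mbm_kernel H t s u + mbm_kernel H s s u <=
  2 * ((2 - 2 * cos ((t - s) * u)) / `|u| `^ (2 * H t + 1)) +
  2 * ((`|u| `^ (- (H t + 2^-1)) - `|u| `^ (- (H s + 2^-1))) ^+ 2 *
       (2 - 2 * cos (s * u))).
Proof.
move=> u0; rewrite !mbm_kernel_diag /mbm_kernel -!powRN.
have nu0 : `|u| != 0 by rewrite normr_eq0.
set A := `|u| `^ (- (H t + 2^-1)); set B := `|u| `^ (- (H s + 2^-1)).
have -> : `|u| `^ (- (2 * H t + 1)) = A * A.
  by rewrite -powRD ?nu0 ?implybT//; congr powR; field.
have -> : `|u| `^ (- (2 * H s + 1)) = B * B.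
  by rewrite -powRD ?nu0 ?implybT//; congr powR; field.
have -> : `|u| `^ (- (H t + H s + 1)) = A * B.
  by rewrite -powRD ?nu0 ?implybT//; congr powR; field.
have -> : (t - s) * u = t * u - s * u by ring.
rewrite cosB.
have et := cos2Dsin2 (t * u); have es := cos2Dsin2 (s * u).
move: et es; set x := cos (t * u); set y := sin (t * u).
set z := cos (s * u); set w := sin (s * u) => et es.
have -> : 2 - 2 * x = (x - 1) ^+ 2 + y ^+ 2 by rewrite (_ : y ^+ 2 = 1 - x ^+ 2); [ring|lra].
have -> : 2 - 2 * z = (z - 1) ^+ 2 + w ^+ 2 by rewrite (_ : w ^+ 2 = 1 - z ^+ 2); [ring|lra].
have -> : 2 - 2 * (x * z + y * w) = (x - z) ^+ 2 + (y - w) ^+ 2.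
  have -> : 2 - 2 * (x * z + y * w) = (x ^+ 2 + y ^+ 2) + (z ^+ 2 + w ^+ 2)
    - 2 * (x * z + y * w) by rewrite et es; ring.
  ring.
(* The deficit in [|p + q|^2 <= 2 |p|^2 + 2 |q|^2] is [|p - q|^2], here written through real and
   imaginary parts. *)
rewrite -subr_ge0 [leRHS](_ : _ = (A * (x - z) - (A - B) * (z - 1)) ^+ 2 +
  (A * (y - w) - (A - B) * w) ^+ 2); last by ring.
by rewrite addr_ge0// sqr_ge0.
Qed.

Lemma mbm_kernel_increment_le {R : realType} (H : R -> R) (th h1 h2 N D t s u : R) :
  0 < th -> 3 * th <= 2 * h1 -> 2 * h2 + 3 * th <= 2 ->
  0 <= s -> s < t -> t <= N -> 1 <= N -> t - s <= 1 ->
  h1 <= H t <= h2 -> h1 <= H s <= h2 ->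
  (0 < s -> (H t - H s) ^+ 2 <= D ^+ 2 * (t - s) `^ th) ->
  mbm_kernel H t t u - 2 * mbm_kernel H t s u + mbm_kernel H s s u <=
  32 * (1 + (th^-1 * D) ^+ 2) * (t - s) `^ th * N `^ (2 * h2 + 3 * th) *
  spectral_weight th u.
Proof.
move=> th0 hth1 hth2 s0 st tN N1 ts1 ht hs hD.
have G0 := spectral_weight_ge0 th u.
have r0 := powR_ge0 (t - s) th.
have Np : 1 <= N `^ (2 * h2 + 3 * th).
  by rewrite -[leLHS](powRr0 N) ler_powR//; move/andP: ht => [? ?]; lra.
have [->|u0] := eqVneq u 0.
  rewrite /mbm_kernel !mulr0 !cos0 !subrr add0r !addNr !mul0r mulr0 subr0 addr0.
  by rewrite !mulr_ge0 ?spectral_weight_ge0 ?addr_ge0 ?sqr_ge0 ?powR_ge0.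
apply: (le_trans (mbm_kernel_increment_split H t s u u0)).
have k1 : (2 - 2 * cos ((t - s) * u)) / `|u| `^ (2 * H t + 1) <=
    16 * (t - s) `^ th * spectral_weight th u.
  by move/andP: ht => [? ?]; apply: (@cos_increment_kernel_le R th h1 h2) => //; lra.
have k2 : (`|u| `^ (- (H t + 2^-1)) - `|u| `^ (- (H s + 2^-1))) ^+ 2 *
    (2 - 2 * cos (s * u)) <=
    16 * ((th^-1 * D) ^+ 2 * (t - s) `^ th) * N `^ (2 * h2 + 3 * th) *
    spectral_weight th u.
  (* The Hölder bound on [H] is available only for [0 < s]; at [s = 0] the factor [2 - 2 cos (s u)]
     vanishes. *)
  have [s00|s00] := eqVneq s 0.
    have -> : cos (s * u) = 1 by rewrite s00 mul0r cos0.
    have Q0 : 0 <= (th^-1 * D) ^+ 2 * (t - s) `^ th by rewrite mulr_ge0 ?sqr_ge0.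
    by rewrite mulr1 subrr mulr0 mulr_ge0// mulr_ge0 ?powR_ge0// mulr_ge0.
  have sp : 0 < s by rewrite lt_def s00.
  apply: (le_trans (@hurst_increment_kernel_le R th h1 h2 N s u (H t) (H s)
    th0 hth1 hth2 s0 _ N1 ht hs u0)); first by lra.
  rewrite ler_wpM2r// ler_wpM2r ?powR_ge0// ler_wpM2l// !exprMn -[leRHS]mulrA ler_wpM2l ?sqr_ge0//.
  exact: hD.
(* The bound [k1] carries no power of [N]; multiplying by a power that is at least 1 puts both terms
   in the same form. *)
have : 16 * (t - s) `^ th * spectral_weight th u * 1 <=
   16 * (t - s) `^ th * spectral_weight th u * N `^ (2 * h2 + 3 * th).
  by rewrite ler_wpM2l// !mulr_ge0.
set Q := (th^-1 * D) ^+ 2 in k2 *; lra.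
Qed.

(** * Variances and Gaussian laws of values and increments *)

Lemma mbm_cov_increment_le {R : realType} (H : R -> R) (th h1 h2 N D t s : R) :
  0 < th -> 3 * th <= 2 * h1 -> 2 * h2 + 3 * th <= 2 ->
  0 <= s -> s < t -> t <= N -> 1 <= N -> t - s <= 1 ->
  h1 <= H t <= h2 -> h1 <= H s <= h2 ->
  (0 < s -> (H t - H s) ^+ 2 <= D ^+ 2 * (t - s) `^ th) ->
  mbm_cov H t t - 2 * mbm_cov H t s + mbm_cov H s s <=
  32 * (1 + (th^-1 * D) ^+ 2) * (t - s) `^ th * N `^ (2 * h2 + 3 * th) *
  Rintegral lebesgue_measure setT (spectral_weight th).
Proof.
move=> th0 hth1 hth2 s0 st tN N1 ts1 ht hs hD.
have t0 : 0 <= t by lra.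
have itt := @integrable_mbm_kernel R H th h1 h2 t t th0 hth1 hth2 t0 t0 ht ht.
have its := @integrable_mbm_kernel R H th h1 h2 t s th0 hth1 hth2 t0 s0 ht hs.
have iss := @integrable_mbm_kernel R H th h1 h2 s s th0 hth1 hth2 s0 s0 hs hs.
have i2ts : lebesgue_measure.-integrable [set: R]
    (EFin \o (fun u => 2 * mbm_kernel H t s u)).
  exact: (integrableZl measurableT _ its).
have iB : lebesgue_measure.-integrable [set: R]
    (EFin \o (fun u => mbm_kernel H t t u - 2 * mbm_kernel H t s u)).
  exact: (integrableB measurableT itt i2ts).
rewrite -[mbm_cov H t t]/(Rintegral lebesgue_measure setT (mbm_kernel H t t)).
rewrite -[mbm_cov H t s]/(Rintegral lebesgue_measure setT (mbm_kernel H t s)).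
rewrite -[mbm_cov H s s]/(Rintegral lebesgue_measure setT (mbm_kernel H s s)).
rewrite -RintegralZl// -RintegralB// -RintegralD// -RintegralZl//; last first.
  exact: integrable_spectral_weight.
apply: le_Rintegral => //.
- exact: (integrableD measurableT iB iss).
- exact: (integrableZl measurableT _ (integrable_spectral_weight _ th0)).
- by move=> u _; exact: (@mbm_kernel_increment_le R H th h1 h2).
Qed.

Lemma mbm_cov_diag_le {R : realType} (H : R -> R) (th h1 h2 N t : R) :
  0 < th -> 3 * th <= 2 * h1 -> 2 * h2 + 3 * th <= 2 ->
  0 <= t -> t <= N -> 1 <= N -> h1 <= H t <= h2 ->
  mbm_cov H t t <= 16 * N `^ (2 * h2 + 3 * th) *
  Rintegral lebesgue_measure setT (spectral_weight th).
Proof.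
move=> th0 hth1 hth2 t0 tN N1 ht.
rewrite -RintegralZl//; last exact: integrable_spectral_weight.
apply: le_Rintegral => //.
- exact: (@integrable_mbm_kernel R H th h1 h2).
- exact: (integrableZl measurableT _ (integrable_spectral_weight _ th0)).
- move=> u _; apply: le_trans (ler_norm _) _.
  exact: (@mbm_kernel_norm_le R H th h1 h2).
Qed.

Lemma is_mbm_single {d} {T : measurableType d} {R : realType}
  (P : probability T R) (H : R -> R) (c : R) (Y : R -> T -> R) (t : R) :
  is_mbm P H c Y -> 0 <= t -> centered_gaussian P (Y t) (c * mbm_cov H t t).
Proof.
move=> mbm t0.
have := mbm 1%N (fun=> t) (fun=> 1) (fun=> t0).
rewrite !big_ord1 !mul1r (_ : (fun _ => _) = Y t)//.
by apply/funext => w; rewrite big_ord1 mul1r.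
Qed.

Lemma is_mbm_increment {d} {T : measurableType d} {R : realType}
  (P : probability T R) (H : R -> R) (c : R) (Y : R -> T -> R) (t s : R) :
  is_mbm P H c Y -> 0 <= t -> 0 <= s ->
  centered_gaussian P (fun w => Y t w - Y s w)
    (c * (mbm_cov H t t - 2 * mbm_cov H t s + mbm_cov H s s)).
Proof.
move=> mbm t0 s0.
pose ts (i : 'I_2) := if i == ord0 then t else s.
pose a (i : 'I_2) : R := if i == ord0 then 1 else - 1.
have ts0 i : 0 <= ts i by rewrite /ts; case: ifP.
have := mbm 2%N ts a ts0.
rewrite !big_ord_recl !big_ord0 /ts /a /=.
rewrite (_ : (fun w => _) = (fun w => Y t w - Y s w)); last first.
  by apply/funext => w; rewrite !big_ord_recl big_ord0 /=; ring.
rewrite (mbm_covC H s t) => h.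
by apply: (eq_ind _ (centered_gaussian P (fun w => Y t w - Y s w)) h); ring.
Qed.

(** * Gaussian tails *)

Lemma measurable_norm_gt {d} {T : measurableType d} {R : realType}
  (X : T -> R) (x : R) :
  measurable_fun setT X -> measurable [set w | (x < `|X w|)%R].
Proof.
move=> mX; rewrite -[X in measurable X]setTI.
have mltr : measurable_fun setT (fun w => x < `|X w|).
  by apply: measurable_fun_ltr => //; exact: measurableT_comp.
exact: (mltr measurableT [set true]).
Qed.

Lemma normal_prob_tail {R : realType} (s x : R) : 0 < s -> 0 <= x ->
  (normal_prob 0 s [set y : R | (x < `|y|)%R] <=
   (2 * expR (- (x ^+ 2 / (4 * s ^+ 2))))%:E)%E.
Proof.
move=> s0 x0.
have mA : measurable [set y : R | (x < `|y|)%R].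
  exact: (@measurable_norm_gt _ R R idfun x (@measurable_id _ R setT)).
have s2 : 0 < 2 * s by rewrite mulr_gt0.
pose e := expR (- (x ^+ 2 / (4 * s ^+ 2))).
(* The density of standard deviation [s] is compared on [x < |y|] with that of
   standard deviation [2 s]. *)
apply: (@le_trans _ _ (\int[lebesgue_measure]_(y in [set y : R | (x < `|y|)%R])
    ((2 * e)%:E * (normal_pdf 0 (2 * s) y)%:E))%E).
  apply: ge0_le_integral => //.
  - by move=> y _; rewrite lee_fin normal_pdf_ge0.
  - by apply/measurable_EFinP; apply: measurable_funTS; exact: measurable_normal_pdf.
  - apply/measurable_EFinP; apply: measurable_funM => //.
    by apply: measurable_funTS; exact: measurable_normal_pdf.
  move=> y /= xy; rewrite -EFinM lee_fin !normal_pdfE ?lt0r_neq0//.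
  rewrite /normal_peak /normal_fun !subr0.
  have -> : Num.sqrt ((2 * s) ^+ 2 * pi *+ 2) = 2 * Num.sqrt (s ^+ 2 * pi *+ 2).
    rewrite exprMn -mulrA -mulrnAr sqrtrM ?sqr_ge0// sqrtr_sqr ger0_norm//.
  set p := Num.sqrt (s ^+ 2 * pi *+ 2).
  have p0 : 0 < p by rewrite sqrtr_gt0 mulrn_wgt0// mulr_gt0 ?exprn_gt0 ?pi_gt0.
  have pE (B : R) : 2 * e * ((2 * p)^-1 * B) = p^-1 * (e * B).
    by field; rewrite lt0r_neq0.
  rewrite pE.
  rewrite ler_wpM2l ?invr_ge0 ?sqrtr_ge0// /e -expRD ler_expR.
  have xy2 : x ^+ 2 <= y ^+ 2.
    by rewrite -[leRHS]real_normK ?num_real// lerXn2r ?nnegrE// ltW.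
  rewrite -subr_ge0.
  have -> : - (x ^+ 2 / (4 * s ^+ 2)) + - y ^+ 2 / ((2 * s) ^+ 2 *+ 2) -
    - y ^+ 2 / (s ^+ 2 *+ 2) = (3 * y ^+ 2 - 2 * x ^+ 2) / (8 * s ^+ 2).
    by field; rewrite lt0r_neq0.
  by rewrite divr_ge0 ?mulr_ge0 ?sqr_ge0//; nra.
rewrite ge0_integralZl//; last 3 first.
- by apply/measurable_EFinP; apply: measurable_funTS; exact: measurable_normal_pdf.
- by move=> y _; rewrite lee_fin normal_pdf_ge0.
- by rewrite lee_fin mulr_ge0 ?expR_ge0.
rewrite -[leRHS]mule1 lee_wpmul2l// ?lee_fin ?mulr_ge0 ?expR_ge0//.
exact: (probability_le1 (normal_prob 0 (2 * s)) mA).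
Qed.

(** The upper bound [V > 0] keeps the exponent meaningful when the variance degenerates: for
    [v <= 0] the variable vanishes almost surely, and the event is null because [0 <= x]. *)
Lemma centered_gaussian_tail {d} {T : measurableType d} {R : realType}
  (P : probability T R) (X : T -> R) (v V x : R) :
  centered_gaussian P X v -> v <= V -> 0 < V -> 0 <= x ->
  (P [set w | (x < `|X w|)%R] <= (2 * expR (- (x ^+ 2 / (4 * V))))%:E)%E.
Proof.
move=> [mX]; have [v0|v0] := ltP 0 v => PX vV V0 x0.
  have mA : measurable [set y : R | (x < `|y|)%R].
    exact: (@measurable_norm_gt _ R R idfun x (@measurable_id _ R setT)).
  have := PX _ mA; rewrite /preimage/= => ->.
  have sv0 : 0 < Num.sqrt v by rewrite sqrtr_gt0.
  apply: (le_trans (normal_prob_tail _ _ sv0 x0)).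
  rewrite sqr_sqrtr ?(ltW v0)// lee_fin ler_pM2l// ler_expR lerN2.
  by rewrite ler_wpM2l ?sqr_ge0// lef_pV2 ?posrE ?mulr_gt0// ler_pM2l.
have mS : measurable [set w | (x < `|X w|)%R].
  exact: measurable_norm_gt.
rewrite (_ : P _ = 0)%E ?lee_fin ?mulr_ge0 ?expR_ge0//.
case: PX => N [mN N0 XN]; apply/eqP; rewrite eq_le measure_ge0 andbT -N0.
apply: le_measure; rewrite ?inE// => w /= xw; apply: XN => /= Xw.
by move: xw; rewrite Xw normr0 ltNge x0.
Qed.

(** * Chaining *)

(** Each dyadic point of level [k] is reached from [a] by at most one increment per level, so the
    increments add up to a geometric series; the additional 1 accounts for [|y a| <= W]. *)
Lemma dyadic_chaining {R : realType} (y : R -> R) (a W rho : R) :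
  0 <= rho < 1 -> `|y a| <= W ->
  (forall k i, (i < 2 ^ k)%N ->
    `|y (a + i.+1%:R / 2 ^+ k) - y (a + i%:R / 2 ^+ k)| <= W * rho ^+ k) ->
  forall k j, (j <= 2 ^ k)%N ->
    `|y (a + j%:R / 2 ^+ k)| <= W * (1 + (1 - rho)^-1).
Proof.
move=> /andP[rho0 rho1] ya dy k.
have W0 : 0 <= W by rewrite (le_trans _ ya).
have r1 : 0 < 1 - rho by rewrite subr_gt0.
(* The induction needs the partial geometric sum up to level [k], to which each new level adds
   exactly [W * rho^(k+1)]. *)
suff H j : (j <= 2 ^ k)%N ->
    `|y (a + j%:R / 2 ^+ k)| <= W * (1 + (1 - rho ^+ k.+1) / (1 - rho)).
  move=> j /H /le_trans; apply; rewrite ler_wpM2l// lerD2l ler_piMl ?invr_ge0 ?(ltW r1)//.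
  by rewrite gerBl exprn_ge0.
elim: k j => [|k IH] j.
  rewrite expn0 expr1 divff ?lt0r_neq0// expr0 divr1 => j1.
  have [->|j0] := eqVneq j 0%N; first by rewrite addr0 (le_trans ya)// ler_peMr//; lra.
  have -> : j = 1%N by lia.
  have := dy 0%N 0%N isT; rewrite !expr0 !divr1 addr0 mulr1 => h.
  have -> : y (a + 1%:R) = (y (a + 1%:R) - y a) + y a by rewrite subrK.
  by apply: (le_trans (ler_normD _ _)); lra.
have eB : W * (1 + (1 - rho ^+ k.+2) / (1 - rho)) =
    W * (1 + (1 - rho ^+ k.+1) / (1 - rho)) + W * rho ^+ k.+1.
  by rewrite (exprS rho k.+1); field; rewrite lt0r_neq0.
have Wr : 0 <= W * rho ^+ k.+1 by rewrite mulr_ge0// exprn_ge0.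
have half (i : nat) : i.*2%:R / 2 ^+ k.+1 = i%:R / 2 ^+ k :> R.
  by rewrite -mul2n natrM exprS; field; rewrite expf_neq0.
rewrite expnS mul2n -{1 2}(odd_double_half j) => jk.
(* A point with even [j] already belongs to level [k]; one with odd [j] is a single increment away
   from its even left neighbour. *)
have [oj|oj] := boolP (odd j); last first.
  rewrite (negbTE oj) add0n half eB in jk *.
  by apply: le_trans (IH _ _) _; [lia|rewrite lerDl].
move: jk; rewrite oj add1n => jk.
have := dy k.+1 j./2.*2 ltac:(rewrite expnS; lia).
rewrite half => h.
set Y1 := y (a + _.+1%:R / _) in h *; set Y0 := y (a + _) in h.
have -> : Y1 = (Y1 - Y0) + Y0 by rewrite subrK.
apply: (le_trans (ler_normD _ _)); rewrite eB addrC lerD//.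
by apply: IH; lia.
Qed.

(** If [|y t|] exceeded the dyadic bound, continuity would carry the excess to a dyadic point close
    to [t], against [dyadic_chaining]. *)
Lemma continuous_chaining {R : realType} (y : R -> R) (a W rho t : R) :
  {within [set t : R | 0 <= t], continuous y} ->
  0 <= a -> a <= t <= a + 1 ->
  0 <= rho < 1 -> `|y a| <= W ->
  (forall k i, (i < 2 ^ k)%N ->
    `|y (a + i.+1%:R / 2 ^+ k) - y (a + i%:R / 2 ^+ k)| <= W * rho ^+ k) ->
  `|y t| <= W * (1 + (1 - rho)^-1).
Proof.
move=> cy a0 /andP[at0 ta] hrho ya dy.
have ch := @dyadic_chaining R y a W rho hrho ya dy.
rewrite leNgt; apply/negP => Bt.
have t0 : 0 <= t by rewrite (le_trans a0).
pose A := [set t : R | 0 <= t].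
have cyt : y x @[x --> within A (nbhs t)] --> y t.
  by rewrite (nbhs_subspace_in (t0 : A t)); exact: cy.
set B := W * _ in Bt.
move/cvgrPdist_lt: cyt => /(_ (`|y t| - B)); rewrite subr_gt0 => /(_ Bt).
rewrite near_withinE => /nbhs_ballP[r /= r0 hr].
have [k _ /(_ k (leqnn k)) kr] := near_infty_natSinv_expn_lt (PosNum r0).
have k2 : 0 < 2 ^+ k :> R by rewrite exprn_gt0.
(* Rounding down keeps the dyadic point between [a] and [t], hence in the domain of continuity and
   with [j <= 2^k]. *)
pose j := Num.truncn ((t - a) * 2 ^+ k).
have /andP[j1 j2] : j%:R <= (t - a) * 2 ^+ k < j.+1%:R.
  by apply: truncn_itv; rewrite mulr_ge0 ?subr_ge0// ltW.
have jk : (j <= 2 ^ k)%N.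
  rewrite -(ler_nat R) natrX (le_trans j1)// ler_piMl ?(ltW k2)//; lra.
have j1' : j%:R / 2 ^+ k <= t - a by rewrite ler_pdivrMr.
have j2' : t - a < j%:R / 2 ^+ k + 1 / 2 ^+ k by rewrite -mulrDl ltr_pdivlMr// natr1.
have j0 : 0 <= j%:R / 2 ^+ k :> R by rewrite divr_ge0// ltW.
have := hr (a + j%:R / 2 ^+ k) _ _.
rewrite /ball/= /A/= ger0_norm; last by lra.
have := ch k j jk; rewrite -/B => h1 h2.
have : `|y t - y (a + j%:R / 2 ^+ k)| < `|y t| - B.
  by apply: h2; [rewrite /= in kr; lra|lra].
have := ler_normD (y t - y (a + j%:R / 2 ^+ k)) (y (a + j%:R / 2 ^+ k)).
by rewrite subrK; lra.
Qed.

(** * Summation of Gaussian tails *)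

Lemma nneseries_le {R : realType} (f : nat -> R) (M : R) :
  (forall i, 0 <= f i) -> (forall n, \sum_(0 <= i < n) f i <= M) ->
  (\sum_(0 <= i <oo) (f i)%:E <= M%:E)%E.
Proof.
move=> f0 fM; apply: lime_le.
  by apply: is_cvg_nneseries => n _ _; rewrite lee_fin.
by apply: nearW => n; rewrite sumEFin lee_fin.
Qed.

Lemma sum_half_expn_le {R : realType} (n : nat) :
  \sum_(0 <= i < n) (2 ^+ i.+1)^-1 <= 1 :> R.
Proof.
suff -> : \sum_(0 <= i < n) (2 ^+ i.+1)^-1 = 1 - (2 ^+ n)^-1 :> R.
  by rewrite gerBl invr_ge0 exprn_ge0.
elim: n => [|n IH]; first by rewrite big_geq// expr0 invr1 subrr.
by rewrite big_nat_recr//= IH exprS; field; rewrite expf_neq0.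
Qed.

Lemma sum_inv_prod_le {R : realType} (n : nat) :
  \sum_(0 <= i < n) (i.+1%:R * i.+2%:R)^-1 <= 1 :> R.
Proof.
suff -> : \sum_(0 <= i < n) (i.+1%:R * i.+2%:R)^-1 = 1 - n.+1%:R^-1 :> R.
  by rewrite gerBl invr_ge0.
elim: n => [|n IH]; first by rewrite big_geq// invr1 subrr.
rewrite big_nat_recr//= IH -!natr1; field.
by rewrite !natr1 !pnatr_eq0.
Qed.

Lemma expRN_le_fact {R : realType} (m : nat) (x : R) : 0 < x ->
  expR (- x) <= m.+1`!%:R / x ^+ m.+1.
Proof.
move=> x0; have := expR_ge1Dxn m (ltW x0).
have f0 : 0 < m.+1`!%:R :> R by rewrite ltr0n fact_gt0.
have xm : 0 < x ^+ m.+1 by rewrite exprn_gt0.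
move=> h; rewrite expRN -(invrK (_ / _)) lef_pV2 ?posrE ?expR_gt0 ?invr_gt0 ?divr_gt0//.
rewrite invf_div; lra.
Qed.

(** The factor [2^k] counts the increments of level [k]. The exponential decays faster than any
    power of its argument, so it absorbs this count and leaves summable weights in [n] and [k]. *)
Lemma dyadic_gaussian_sum {R : realType} (b th : R) : 0 < b -> 0 < th ->
  exists2 S : R, 0 < S & forall n k : nat,
    2 ^+ k * (2 * expR (- (b * n.+1%:R `^ th * 2 `^ (th * k%:R)))) <=
    S * (n.+1%:R * n.+2%:R)^-1 * (2 ^+ k.+1)^-1.
Proof.
(* This [m] gives [th * (m + 1) >= 2], so the power [m + 1] of the argument dominates
   [(n + 1)^2 * 4^k]. *)
move=> b0 th0; pose m := Num.truncn (2 / th).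
have mth : 2 <= th * m.+1%:R.
  by rewrite mulrC -ler_pdivrMr// ltW// truncnS_gt.
exists (8 * (m.+1`!%:R / b ^+ m.+1)).
  by rewrite mulr_gt0// divr_gt0 ?exprn_gt0// ltr0n fact_gt0.
move=> n k.
have n1 : 1 <= n.+1%:R :> R by rewrite ler1n.
have n0 : 0 < n.+1%:R :> R by [].
set N := n.+1%:R in n1 n0 *.
have e2 : n.+2%:R = N + 1 :> R by rewrite natr1.
rewrite e2.
set F := m.+1`!%:R.
have F0 : 0 < F :> R by rewrite ltr0n fact_gt0.
pose X := b * N `^ th * 2 `^ (th * k%:R).
have X0 : 0 < X by rewrite !mulr_gt0// powR_gt0.
have bm : 0 < b ^+ m.+1 by rewrite exprn_gt0.
have k2 : 0 < 2 ^+ k :> R by rewrite exprn_gt0.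
have NX : N ^+ 2 <= (N `^ th) ^+ m.+1.
  by rewrite -[leRHS]powR_mulrn ?powR_ge0// -powRrM -[leLHS]powR_mulrn ?(ltW n0)// ler_powR.
have kX : (2 ^+ k) ^+ 2 <= (2 `^ (th * k%:R)) ^+ m.+1 :> R.
  rewrite -[leRHS]powR_mulrn ?powR_ge0// -powRrM -exprM -[leLHS]powR_mulrn// ler_powR ?ler1n// natrM.
  by rewrite mulrAC [leRHS]mulrC ler_wpM2l.
have Xm : b ^+ m.+1 * (N ^+ 2 * (2 ^+ k) ^+ 2) <= X ^+ m.+1.
  rewrite /X !exprMn -mulrA ler_pM2l//.
  by rewrite ler_pM ?sqr_ge0.
have D0 : 0 < b ^+ m.+1 * (N ^+ 2 * (2 ^+ k) ^+ 2) by rewrite !mulr_gt0 ?exprn_gt0.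
have h : expR (- X) <= F / (b ^+ m.+1 * (N ^+ 2 * (2 ^+ k) ^+ 2)).
  apply: (le_trans (expRN_le_fact m X X0)).
  by rewrite ler_pM2l// lef_pV2 ?posrE// exprn_gt0.
apply: (@le_trans _ _ (2 ^+ k * (2 * (F / (b ^+ m.+1 * (N ^+ 2 * (2 ^+ k) ^+ 2)))))).
  by rewrite !ler_pM2l.
have N1 : N + 1 <= 2 * N by lra.
rewrite (exprS 2 k) -subr_ge0.
have -> : 8 * (F / b ^+ m.+1) / (N * (N + 1)) / (2 * 2 ^+ k) -
    2 ^+ k * (2 * (F / (b ^+ m.+1 * (N ^+ 2 * (2 ^+ k) ^+ 2)))) =
    2 * (F / b ^+ m.+1) * (2 * N - (N + 1)) / (N ^+ 2 * (N + 1) * 2 ^+ k).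
  by field; rewrite !lt0r_neq0//; lra.
rewrite divr_ge0//; first by rewrite mulr_ge0 ?subr_ge0// mulr_ge0// divr_ge0// ltW.
by rewrite !mulr_ge0 ?ltW//; lra.
Qed.

(** * Supremum of a Gaussian family *)

Lemma ereal_sup_gtP {R : realType} (S : set (\bar R)) (x : \bar R) :
  (x < ereal_sup S)%E <-> exists2 y, S y & (x < y)%E.
Proof.
split=> [xS|[y Sy xy]]; last by rewrite (lt_le_trans xy)//; exact: ereal_sup_ubound.
apply: contrapT => h; move: xS; rewrite ltNge => /negP; apply.
apply: ge_ereal_sup => y Sy; rewrite leNgt; apply/negP => xy.
by apply: h; exists y.
Qed.

Lemma gaussian_decay_cvg0 {R : realType} (C1 C2 e : R) :
  0 < C1 -> 0 < C2 -> 0 < e -> exists2 u : R, 0 < u & C1 * expR (- (C2 * u ^+ 2)) <= e.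
Proof.
(* The witness makes [e * C2 * u >= C1]; then [u <= u^2] and [1 + y <= e^y] conclude. *)
move=> C10 C20 e0; exists (1 + C1 / (C2 * e)).
  by rewrite addr_gt0// divr_gt0// mulr_gt0.
set u := 1 + _.
have Ce0 : 0 < C1 / (C2 * e) by rewrite divr_gt0// mulr_gt0.
have u1 : 1 <= u by rewrite lerDl ltW.
rewrite expRN ler_pdivrMr ?expR_gt0//.
have h := expR_ge1Dx (C2 * u ^+ 2).
have uu : u <= u ^+ 2 by rewrite expr2 ler_peMr//; lra.
have : C1 <= e * (C2 * u).
  have -> : e * (C2 * u) = C2 * e + C1 by rewrite /u; field; rewrite !lt0r_neq0.
  by rewrite lerDr mulr_ge0// ltW.
have : e * (C2 * u) <= e * (C2 * u ^+ 2) by rewrite ler_pM2l// ler_pM2l.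
have : e * (1 + C2 * u ^+ 2) <= e * expR (C2 * u ^+ 2) by rewrite ler_pM2l.
lra.
Qed.

(** The variable [xi] is the supremum of all [|X n k i|]. The event that it exceeds [u] is the
    countable union [A u], estimated by Boole's inequality over [i], then [k], then [n]. *)
Lemma gaussian_family_sup {d} {T : measurableType d} {R : realType}
  (P : probability T R) (X : nat -> nat -> nat -> T -> R) (b th : R) :
  (forall n k i, measurable_fun setT (X n k i)) -> 0 < b -> 0 < th ->
  (forall n k i (u : R), (i < 2 ^ k)%N -> 0 <= u ->
    (P [set w | (u < `|X n k i w|)%R] <=
     (2 * expR (- (u ^+ 2 * (b * n.+1%:R `^ th * 2 `^ (th * k%:R)))))%:E)%E) ->
  exists xi : T -> R,
    [/\ measurable_fun setT xi,
        (forall w, 0 <= xi w),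
        {ae P, forall w, forall n k i, (i < 2 ^ k)%N -> `|X n k i w| <= xi w} &
        exists C1 C2 : R, [/\ 0 < C1, 0 < C2 &
          forall u : R, 0 < u ->
            (P [set w | (u < xi w)%R] <= ((C1 * expR (- (C2 * u ^+ 2)))%R)%:E)%E]].
Proof.
move=> mX b0 th0 PX.
pose B (u : R) n k i : set T := [set w | u < `|X n k i w|].
pose A (u : R) : set T := \bigcup_n \bigcup_k \big[setU/set0]_(i < 2 ^ k) B u n k i.
have mB u n k i : measurable (B u n k i) by exact: measurable_norm_gt.
have mBk u n k : measurable (\big[setU/set0]_(i < 2 ^ k) B u n k i).
  by apply: bigsetU_measurable.
have mBn u n : measurable (\bigcup_k \big[setU/set0]_(i < 2 ^ k) B u n k i).
  exact: bigcup_measurable.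
have mA u : measurable (A u) by exact: bigcup_measurable.
pose xi0 w : \bar R := ereal_sup
  [set x | exists n k i, (i < 2 ^ k)%N /\ x = (`|X n k i w|)%:E].
have xi0P (u : R) w : (u%:E < xi0 w)%E <-> A u w.
  split=> [/ereal_sup_gtP[_ [n [k [i [ik ->]]]]]|[n _ [k _]]].
    rewrite lte_fin => uX; exists n => //; exists k => //.
    by rewrite -bigcup_mkord; exists i.
  rewrite -bigcup_mkord => -[i /= ik uX]; apply/ereal_sup_gtP.
  by exists (`|X n k i w|)%:E => //; exists n, k, i.
have xi0_ge0 w : (0 <= xi0 w)%E.
  apply: le_trans (ereal_sup_ubound _); last by exists 0%N, 0%N, 0%N; split; last reflexivity.
  by rewrite lee_fin.
have mxi0 : measurable_fun setT xi0.
  apply: (measurability _ (ErealGenOInfty.measurableE R)) => //.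
  move=> _ [_ [u ->] <-]; rewrite setTI.
  rewrite (_ : _ @^-1` _ = A u)//.
  apply/seteqP; split => w /=; rewrite in_itv/= andbT; first by move/xi0P.
  by move=> Aw; apply/xi0P.
(* [fine] sends an infinite supremum to 0; the domination by [xi] is lost only on that event, shown
   below to be null. *)
pose xi w := fine (xi0 w).
have mxi : measurable_fun setT xi by apply: measurableT_comp mxi0; exact: fine_measurable.
pose C2 := b / 2.
have C20 : 0 < C2 by rewrite divr_gt0.
have [S S0 HS] := dyadic_gaussian_sum C2 th C20 th0.
(* [S] serves for [1 <= u]; the term [expR C2] makes the bound at least 1, hence trivial, for
   [u < 1]. *)
pose C1 := S + expR C2.
have C10 : 0 < C1 by rewrite addr_gt0// expR_gt0.
have PA (u : R) : 0 < u -> (P (A u) <= (C1 * expR (- (C2 * u ^+ 2)))%:E)%E.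
  move=> u0; have [u1|u1] := leP 1 u; last first.
    apply: (@le_trans _ _ 1%E); first exact: probability_le1.
    rewrite lee_fin (@le_trans _ _ (expR C2 * expR (- (C2 * u ^+ 2))))//.
      rewrite -expRD -[leLHS]expR0 ler_expR subr_ge0 ler_piMr ?(ltW C20)//.
      by rewrite expr_le1 ?ltW.
    by rewrite ler_wpM2r ?expR_ge0// lerDr ltW.
  pose E := expR (- (C2 * u ^+ 2)).
  have E0 : 0 < E by exact: expR_gt0.
  have Pk n k : (P (\big[setU/set0]_(i < 2 ^ k) B u n k i) <=
      (E * S * (n.+1%:R * n.+2%:R)^-1 * (2 ^+ k.+1)^-1)%:E)%E.
    apply: (le_trans (Boole_inequality _ _)) => //.
    set g := b * n.+1%:R `^ th * 2 `^ (th * k%:R).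
    have gb : b <= g.
      rewrite /g -mulrA ler_peMr ?(ltW b0)// -[leLHS]mulr1 ler_pM//.
        by rewrite -[leLHS](powRr0 n.+1%:R) ler_powR ?ler1n// ltW.
      by rewrite -[leLHS](powRr0 2) ler_powR ?ler1n// mulr_ge0// ltW.
    (* As [u^2 >= 1] and [g >= b], half of [u^2 g] is at least [C2 u^2] and the other half at least
       [g / 2]: one gives the tail in [u], the other the summability. *)
    have eg : expR (- (u ^+ 2 * g)) <= E * expR (- (g / 2)).
      rewrite /E -expRD ler_expR /C2.
      have u2 : 1 <= u ^+ 2 by rewrite expr_ge1// ltW.
      nra.
    apply: (@le_trans _ _ (\sum_(i < 2 ^ k) (2 * (E * expR (- (g / 2))))%:E)%E).
      apply: lee_sum => i _; apply: (le_trans (PX n k i u (ltn_ord i) (ltW u0))).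
      by rewrite lee_fin ler_pM2l.
    rewrite sumEFin lee_fin sumr_const card_ord -[leLHS]mulr_natl natrX.
    have := HS n k; rewrite (_ : C2 * _ * _ = g / 2); last by rewrite /g /C2; ring.
    move=> /(ler_wpM2l (ltW E0)); rewrite !mulrA => h; apply: le_trans h.
    by rewrite le_eqVlt; apply/orP; left; apply/eqP; ring.
  have Pn n : (P (\bigcup_k \big[setU/set0]_(i < 2 ^ k) B u n k i) <=
      (E * S * (n.+1%:R * n.+2%:R)^-1)%:E)%E.
    have cn0 : 0 <= E * S * (n.+1%:R * n.+2%:R)^-1.
      by rewrite mulr_ge0 ?invr_ge0 ?mulr_ge0// ltW.
    apply: (le_trans (generalized_Boole_inequality P _ _)) => //.
    apply: (@le_trans _ _ (\sum_(0 <= k <oo)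
        (E * S * (n.+1%:R * n.+2%:R)^-1 * (2 ^+ k.+1)^-1)%:E)%E).
      by apply: lee_nneseries => // k _; exact: Pk.
    apply: nneseries_le => [i|m].
      by rewrite mulr_ge0// invr_ge0 exprn_ge0.
    by rewrite -mulr_sumr ler_piMr// sum_half_expn_le.
  apply: (@le_trans _ _ (E * S)%:E).
    apply: (le_trans (generalized_Boole_inequality P (mBn u) (mA u))).
    apply: (@le_trans _ _ (\sum_(0 <= n <oo) (E * S * (n.+1%:R * n.+2%:R)^-1)%:E)%E).
      by apply: lee_nneseries => // n _; exact: Pn.
    have ES0 : 0 <= E * S by rewrite mulr_ge0// ltW.
    apply: nneseries_le => [i|m].
      by rewrite mulr_ge0// invr_ge0 mulr_ge0.
    by rewrite -mulr_sumr ler_piMr// sum_inv_prod_le.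
  by rewrite lee_fin mulrC ler_pM2r// lerDl expR_ge0.
exists xi; split => //.
- by move=> w; exact: fine_ge0.
(* The event of an infinite supremum lies in every [A u], whose probability is arbitrarily small for
   suitable [u]. *)
- exists (xi0 @^-1` [set +oo%E]); split.
  + by rewrite -[X in measurable X]setTI; exact: mxi0.
  + apply/eqP; rewrite eq_le measure_ge0 andbT; apply/lee_addgt0Pr => e e0.
    rewrite add0e; have [u u0 ue] := gaussian_decay_cvg0 C1 C2 e C10 C20 e0.
    apply: (@le_trans _ _ (P (A u))).
      apply: le_measure; rewrite ?inE//.
        by rewrite -[X in measurable X]setTI; exact: mxi0.
      by move=> w /= xiy; apply/xi0P; rewrite xiy ltry.
    by apply: (le_trans (PA u u0)); rewrite lee_fin.
  + move=> w /= h; apply: contrapT => xiNy; apply: h => n k i ik.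
    rewrite -lee_fin fineK; last by rewrite ge0_fin_numE// ltey; apply/eqP.
    by apply: ereal_sup_ubound; exists n, k, i.
- exists C1, C2; split => // u u0; apply: le_trans (PA u u0).
  apply: le_measure; rewrite ?inE//.
    rewrite -[X in measurable X]setTI.
    have mltr : measurable_fun setT (fun w => u < xi w) by exact: measurable_fun_ltr.
    exact: (mltr measurableT [set true]).
  move=> w /=; rewrite /xi => uxi; apply/xi0P.
  by move: uxi; case: (xi0 w) (xi0_ge0 w) => [r|//|//] /=; rewrite ?ltry// lte_fin.
Qed.

(** * Normalised increments and the growth bound *)

Lemma centered_gaussian_scaled_tail {d} {T : measurableType d} {R : realType}
  (P : probability T R) (X : T -> R) (v V wt g u : R) :
  centered_gaussian P X v -> v <= V -> 0 < V -> 0 < wt -> 4 * V * g <= wt ^+ 2 ->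
  0 <= u ->
  (P [set w | (u < `|X w / wt|)%R] <= (2 * expR (- (u ^+ 2 * g)))%:E)%E.
Proof.
move=> gX vV V0 wt0 gV u0.
have -> : [set w | (u < `|X w / wt|)%R] = [set w | (u * wt < `|X w|)%R].
  apply/seteqP; split => w /=; by rewrite normrM (gtr0_norm (_ : 0 < wt^-1)) ?invr_gt0// ltr_pdivlMr.
have uw0 : 0 <= u * wt by rewrite mulr_ge0// ltW.
(* The exponent obtained is [u^2 wt^2 / (4 V)], and the hypothesis on [g] says that it is at least
   [u^2 g]. *)
apply: (le_trans (centered_gaussian_tail P X v V (u * wt) gX vV V0 uw0)).
rewrite lee_fin ler_pM2l// ler_expR lerN2 exprMn ler_pdivlMr ?mulr_gt0//.
by rewrite -mulrA ler_wpM2l ?sqr_ge0// mulrC.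
Qed.

(** Since [n + 1 <= 2 max(t, 1)], the weight attached to the cell [[n, n + 1]] is turned into the
    factor of the theorem at the cost of [2^a]. *)
Lemma powR_max1_ge {R : realType} (n : nat) (t a : R) : 0 <= a -> n%:R <= t ->
  n.+1%:R `^ a <= 2 `^ a * Num.max (t `^ a) 1.
Proof.
move=> a0 nt; have t0 : 0 <= t by rewrite (le_trans _ nt).
have [t1|t1] := leP 1 t.
  apply: (@le_trans _ _ (2 `^ a * t `^ a)); last by rewrite ler_wpM2l ?powR_ge0// le_max lexx.
  rewrite -powRM// ge0_ler_powR// ?nnegrE ?mulr_ge0// -natr1; lra.
apply: (@le_trans _ _ (2 `^ a * 1)); last by rewrite ler_wpM2l ?powR_ge0// le_max lexx orbT.
rewrite mulr1 ge0_ler_powR// ?nnegrE// -natr1; lra.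
Qed.

(** Squaring the Hölder bound gives [(t - s)^(2 kappa)], at most [(t - s)^th] because [t - s <= 1]
    and [th <= 2 kappa]. *)
Lemma mbm_increment_variance_le {R : realType} (H : R -> R) (h1 h2 D kappa th N t s : R) :
  (forall t, 0 <= t -> h1 <= H t <= h2) ->
  (forall t s, 0 < s -> s <= t -> `|H t - H s| <= D * (t - s) `^ kappa) ->
  0 < th -> 3 * th <= 2 * h1 -> 2 * h2 + 3 * th <= 2 -> th <= 2 * kappa -> 0 < D ->
  0 <= s -> s < t -> t <= N -> 1 <= N -> t - s <= 1 ->
  mbm_cov H t t - 2 * mbm_cov H t s + mbm_cov H s s <=
  32 * (1 + (th^-1 * D) ^+ 2) * (t - s) `^ th * N `^ (2 * h2 + 3 * th) *
  Rintegral lebesgue_measure setT (spectral_weight th).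
Proof.
move=> Hb HD th0 th1 th2 thk D0 s0 st tN N1 ts1.
apply: (@mbm_cov_increment_le R H th h1 h2) => //; [by apply: Hb; lra|exact: Hb|].
move=> sp; have h := HD t s sp (ltW st).
have ts0 : 0 < t - s by rewrite subr_gt0.
apply: (@le_trans _ _ ((D * (t - s) `^ kappa) ^+ 2)).
  by rewrite -[leLHS]real_normK ?num_real// lerXn2r ?nnegrE// (le_trans _ h).
rewrite exprMn ler_wpM2l ?sqr_ge0// -[leLHS]powR_mulrn ?powR_ge0// -powRrM.
by rewrite ger_powR ?ts0// mulrC.
Qed.

Theorem theorem6 (d : measure_display) (T : measurableType d) (R : realType)
  (P : probability T R) (H : R -> R) (h1 h2 D kappa c : R) (Y : R -> T -> R) :
  {within [set t : R | 0 <= t], continuous H} ->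
  (forall t, 0 <= t -> 0 < H t < 1) ->
  0 < h1 -> h1 < h2 -> h2 < 1 ->
  (forall t, 0 <= t -> h1 <= H t <= h2) ->
  0 < D -> 0 < kappa <= 1 ->
  (forall t s, 0 < s -> s <= t -> `|H t - H s| <= D * (t - s) `^ kappa) ->
  0 < c ->
  is_mbm P H c Y ->
  {ae P, forall w, {within [set t : R | 0 <= t], continuous (fun t => Y t w)}} ->
  forall delta : R, 0 < delta ->
  exists xi : T -> R,
    [/\ measurable_fun setT xi,
        (forall w, 0 <= xi w),
        {ae P, forall w, forall t : R, 0 < t ->
            `|Y t w| <= Num.max (t `^ (h2 + delta)) 1 * xi w} &
        exists C1 C2 : R, [/\ 0 < C1, 0 < C2 &
          forall u : R, 0 < u ->
            (P [set w | (u < xi w)%R] <= ((C1 * expR (- (C2 * u ^+ 2)))%R)%:E)%E]].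
Proof.
move=> _ _ h10 h12 h21 Hb D0 /andP[k0 _] HD c0 mbm Ycont delta delta0.
(* The four terms of the minimum give, in order, [3 th <= 2 h1], [2 h2 + 3 th <= 2], the gap between
   [3 th] and [2 delta], and [th <= 2 kappa]. *)
pose th : R := Num.min (Num.min h1 (1 - h2)) (Num.min delta kappa) / 2.
have th0 : 0 < th by rewrite divr_gt0// !lt_min h10 delta0 k0 subr_gt0 h21.
have [thh1 thh2 thd thk] : [/\ 2 * th <= h1, 2 * th <= 1 - h2,
    2 * th <= delta & 2 * th <= kappa].
  have -> : 2 * th = Num.min (Num.min h1 (1 - h2)) (Num.min delta kappa).
    by rewrite mulrC mulfVK.
  by rewrite !ge_min !lexx !orbT.
have th1 : 3 * th <= 2 * h1 by lra.
have th2 : 2 * h2 + 3 * th <= 2 by lra.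
pose I := Rintegral lebesgue_measure setT (@spectral_weight R th).
have I0 : 0 <= I by apply: Rintegral_ge0 => u _; exact: spectral_weight_ge0.
pose Q := (th^-1 * D) ^+ 2.
have Q0 : 0 <= Q by exact: sqr_ge0.
(* The constant dominates both variance bounds; adding 1 makes it positive from [0 <= I] alone. *)
pose Cv := c * (32 * (1 + Q) * I) + 1.
have Cv0 : 0 < Cv by rewrite ltr_wpDl// !mulr_ge0// ?(ltW c0)// addr_ge0.
pose a := h2 + delta.
have a0 : 0 <= a by rewrite /a; lra.
pose gam := 2 * h2 + 3 * th.
pose wt n : R := n.+1%:R `^ a.
have wt0 n : 0 < wt n by rewrite powR_gt0.
(* Increments of mesh [2^-k] have variance of order [2^(-th k)], whereas [rho^(2k) = 2^(-th k / 2)]: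
   normalising by [rho^k] leaves a variance that still decays in [k]. *)
pose rho : R := 2 `^ (- (th / 4)).
have rho0 : 0 < rho by rewrite powR_gt0.
have rho1 : rho < 1.
  rewrite /rho powRN invf_lt1 ?powR_gt0//.
  have : 1 `^ (th / 4) < 2 `^ (th / 4) :> R.
    apply: gt0_ltr_powR; rewrite ?nnegrE//; first by rewrite divr_gt0.
    by rewrite ltr1n.
  by rewrite powR1.
(* The 8 is the 4 of the Gaussian tail times a 2 that pays for the shift between level [k + 1] of
   [X] and mesh [2^-k]. *)
pose b := (8 * Cv)^-1.
have b0 : 0 < b by rewrite invr_gt0 mulr_gt0.
pose dt n k i w := Y (n%:R + i.+1%:R / 2 ^+ k) w - Y (n%:R + i%:R / 2 ^+ k) w.
(* Level [0] is [Y n]; level [k + 1] holds the increments of mesh [2^-k], and the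
   modulus keeps the index in range whatever [i] is. *)
pose X n k i w := if k is k'.+1 then dt n k' (i %% 2 ^ k')%N w / (wt n * rho ^+ k')
  else Y n%:R w / wt n.
have pt0 n k i : 0 <= n%:R + i%:R / 2 ^+ k :> R.
  by rewrite addr_ge0// divr_ge0// exprn_ge0.
have gd n k i : centered_gaussian P (dt n k i) _ :=
  is_mbm_increment P H c Y _ _ mbm (pt0 n k i.+1) (pt0 n k i).
have gY n : centered_gaussian P (Y n%:R) _ := is_mbm_single P H c Y _ mbm (ler0n R n).
have mX n k i : measurable_fun setT (X n k i).
  case: k => [|k]; apply: measurable_funM => //.
    by case: (gY n).
  by case: (gd n k (i %% 2 ^ k)%N).
(* This is where [2 th <= delta] enters: [gam + th / 2 = 2 h2 + 7 th / 2] is at most [2 a]. The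
   spare [th / 2] gives the summability in [n]. *)
have Nwt n : n.+1%:R `^ gam * n.+1%:R `^ (th / 2) <= wt n ^+ 2.
  rewrite /wt -[leRHS]powR_mulrn ?powR_ge0// -powRrM -powRD; last by rewrite pnatr_eq0 implybT.
  by rewrite ler_powR ?ler1n// /gam /a; lra.
have Ng0 n : 0 < n.+1%:R `^ gam :> R by rewrite powR_gt0.
have PX n k i (u : R) : (i < 2 ^ k)%N -> 0 <= u ->
    (P [set w | (u < `|X n k i w|)%R] <=
     (2 * expR (- (u ^+ 2 * (b * n.+1%:R `^ (th / 2) * 2 `^ (th / 2 * k%:R)))))%:E)%E.
  move=> ik u0; have N1 : 1 <= n.+1%:R :> R by rewrite ler1n.
  case: k ik => [|k] ik.
    apply: (centered_gaussian_scaled_tail P (Y n%:R) _ (Cv * n.+1%:R `^ gam) _ _ _ (gY n)) => //.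
    - have nN : n%:R <= n.+1%:R :> R by rewrite ler_nat.
      have h := mbm_cov_diag_le H th h1 h2 n.+1%:R n%:R th0 th1 th2 (ler0n R n) nN N1
        (Hb _ (ler0n R n)).
      have := ler_wpM2l (ltW c0) h; rewrite -/I -/gam.
      have Z0 : 0 <= c * I * n.+1%:R `^ gam by rewrite !mulr_ge0// ltW.
      have : 0 <= Q * (c * I * n.+1%:R `^ gam) by rewrite mulr_ge0.
      have := Ng0 n; rewrite /Cv; set N := _ `^ gam in Z0 *; lra.
    - by rewrite mulr_gt0.
    - rewrite mulr0 powRr0 mulr1; apply: le_trans (Nwt n).
      have -> : 4 * (Cv * n.+1%:R `^ gam) * (b * n.+1%:R `^ (th / 2)) =
          2^-1 * (n.+1%:R `^ gam * n.+1%:R `^ (th / 2)).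
        by rewrite /b; field; rewrite lt0r_neq0.
      have : 0 <= n.+1%:R `^ gam * n.+1%:R `^ (th / 2) :> R by rewrite mulr_ge0 ?powR_ge0.
      lra.
  pose q : R := 2 `^ (th / 2 * k%:R).
  have q0 : 0 < q by rewrite powR_gt0.
  have q1 : (rho ^+ k) ^+ 2 = q^-1.
    by rewrite -exprM -powR_mulrn ?powR_ge0// -powRrM -powRN natrM; congr powR; field.
  have q2 : (2 ^+ k)^-1 `^ th = q^-1 ^+ 2.
    rewrite -powR_mulrn// -powRN -powRrM -powRN -powR_mulrn ?powR_ge0// -powRrM.
    by congr powR; field.
  (* Passing from [k] to [k + 1] costs [2^(th / 2)], at most 2 since [th <= 2]. *)
  have q3 : 2 `^ (th / 2 * k.+1%:R) <= 2 * q.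
    rewrite -(natr1 k) mulrDr mulr1 powRD ?pnatr_eq0 ?implybT// mulrC ler_wpM2r ?(ltW q0)//.
    rewrite -[leRHS]powRr1//; apply: ler_powR; [by rewrite ler1n|lra].
  move: ik => _; set j := (i %% 2 ^ k)%N.
  have ik : (j < 2 ^ k)%N by rewrite ltn_mod expn_gt0.
  have dts : (n%:R + j.+1%:R / 2 ^+ k) - (n%:R + j%:R / 2 ^+ k) = (2 ^+ k)^-1 :> R.
    by rewrite -natr1; field; rewrite expf_neq0.
  have k2 : 0 < (2 ^+ k)^-1 :> R by rewrite invr_gt0 exprn_gt0.
  rewrite /X -/j.
  apply: (centered_gaussian_scaled_tail P (dt n k j) _ (Cv * (q^-1 ^+ 2 * n.+1%:R `^ gam))
    (wt n * rho ^+ k) (b * n.+1%:R `^ (th / 2) * 2 `^ (th / 2 * k.+1%:R)) u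
    (gd n k j)) => //.
  - have h := mbm_increment_variance_le H h1 h2 D kappa th n.+1%:R
      (n%:R + j.+1%:R / 2 ^+ k) (n%:R + j%:R / 2 ^+ k) Hb HD th0 th1 th2 _ D0 (pt0 n k j).
    have {h} := h ltac:(lra); rewrite -subr_gt0 dts => /(_ k2) h.
    have tN : n%:R + j.+1%:R / 2 ^+ k <= n.+1%:R :> R.
      by rewrite -(natr1 n) lerD2l ler_pdivrMr ?exprn_gt0// mul1r -natrX ler_nat.
    have k21 : (2 ^+ k)^-1 <= 1 :> R by rewrite invf_le1 ?exprn_gt0// exprn_ege1// ler1n.
    have := ler_wpM2l (ltW c0) (h tN N1 k21); rewrite -/I -/gam -/Q q2.
    have Z0 : 0 <= q^-1 ^+ 2 * n.+1%:R `^ gam by rewrite mulr_ge0 ?sqr_ge0// ltW.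
    move: Z0; rewrite /Cv; set N := _ `^ gam; set q' := _ ^+ 2 => Z0 h'.
    apply: (le_trans h'); lra.
  - have qi0 : 0 < q^-1 ^+ 2 by rewrite exprn_gt0// invr_gt0.
    by rewrite mulr_gt0// mulr_gt0.
  - by rewrite mulr_gt0// exprn_gt0.
  - rewrite exprMn q1.
    apply: (@le_trans _ _ (4 * (Cv * (q^-1 ^+ 2 * n.+1%:R `^ gam)) *
        (b * n.+1%:R `^ (th / 2) * (2 * q)))).
      have qi0 : 0 <= q^-1 ^+ 2 * n.+1%:R `^ gam by rewrite mulr_ge0 ?sqr_ge0 ?powR_ge0.
      have bN : 0 <= b * n.+1%:R `^ (th / 2) by rewrite mulr_ge0 ?powR_ge0// ltW.
      have CV : 0 <= 4 * (Cv * (q^-1 ^+ 2 * n.+1%:R `^ gam)).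
        by rewrite mulr_ge0// mulr_ge0// ltW.
      by rewrite (ler_wpM2l CV)// ler_wpM2l.
    have -> : 4 * (Cv * (q^-1 ^+ 2 * n.+1%:R `^ gam)) *
        (b * n.+1%:R `^ (th / 2) * (2 * q)) =
        (n.+1%:R `^ gam * n.+1%:R `^ (th / 2)) * q^-1.
      by rewrite /b; field; rewrite !lt0r_neq0.
    by rewrite ler_wpM2r ?invr_ge0 ?(ltW q0).
have th20 : 0 < th / 2 by rewrite divr_gt0.
have [xi1 [mxi1 xi10 Xxi1 [C1 [C2 [C10 C20 tail]]]]] :=
  gaussian_family_sup P X b (th / 2) mX b0 th20 PX.
(* The factor [2^a] comes from [powR_max1_ge], the other from chaining. *)
pose K := 2 `^ a * (1 + (1 - rho)^-1).
have r1 : 0 < 1 + (1 - rho)^-1 by rewrite addr_gt0// invr_gt0 subr_gt0.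
have K0 : 0 < K by rewrite mulr_gt0// powR_gt0.
exists (fun w => K * xi1 w); split.
- exact: measurable_funM.
- by move=> w; rewrite mulr_ge0// ltW.
- apply: filterS2 Ycont Xxi1 => w cw Xw t t0.
  pose n := Num.truncn t.
  have /andP[nt tn] := truncn_itv (ltW t0).
  have wx0 : 0 <= wt n * xi1 w by rewrite mulr_ge0// ltW.
  have tn1 : n%:R <= t <= n%:R + 1 by rewrite nt natr1 ltW.
  have h0 : `|Y n%:R w| <= wt n * xi1 w.
    have := Xw n 0%N 0%N isT; rewrite /X normrM (gtr0_norm (_ : 0 < _^-1)) ?invr_gt0//.
    by rewrite ler_pdivrMr// mulrC.
  have hd k i : (i < 2 ^ k)%N -> `|Y (n%:R + i.+1%:R / 2 ^+ k) w -
      Y (n%:R + i%:R / 2 ^+ k) w| <= wt n * xi1 w * rho ^+ k.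
    move=> ik; have wr0 : 0 < wt n * rho ^+ k by rewrite mulr_gt0// exprn_gt0.
    (* The index bound at level [k + 1] is [2^(k+1)], so [i < 2^k] is admissible, and the modulus
       then acts trivially on [i]. *)
    have := Xw n k.+1 i ltac:(by rewrite expnS mul2n -addnn ltn_addr).
    rewrite /X modn_small// normrM (gtr0_norm (_ : 0 < _^-1)) ?invr_gt0//.
    by rewrite ler_pdivrMr// mulrC mulrAC.
  have rho01 : 0 <= rho < 1 by rewrite ltW.
  apply: (le_trans (continuous_chaining (Y ^~ w) n%:R _ rho t cw (ler0n R n) tn1 rho01 h0 hd)).
  have := powR_max1_ge n t a a0 nt; rewrite -/(wt n) -/a => h.
  rewrite /K; have := ler_wpM2r (mulr_ge0 (xi10 w) (ltW r1)) h.
  by rewrite !mulrA (mulrAC _ (2 `^ a)) (mulrC (2 `^ a)); lra.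
(* The tail of [K * xi1] at [u] is that of [xi1] at [u / K]. *)
- exists C1, (C2 / K ^+ 2); split => //; first by rewrite divr_gt0// exprn_gt0.
  move=> u u0; have uK : 0 < u / K by rewrite divr_gt0.
  have := tail _ uK.
  rewrite (_ : [set w | u / K < xi1 w] = [set w | u < K * xi1 w]); last first.
    by apply/seteqP; split => w /=; rewrite ltr_pdivrMr// mulrC.
  by rewrite exprMn exprVn mulrA mulrAC.
Qed.
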